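(* Let $D_1$ be a periodic first-derivative SBP operator and $D_2$ a periodic second-derivative SBP operator on the same grid with $N$ nodes and with the same diagonal mass matrix $M$. Let $g>0$, let $\boldsymbol D=(D(x_1),\dots,D(x_N))^T\in\mathbb R^N$ be the vector of still water depths at the grid nodes, and let $K=\operatorname{diag}(\boldsymbol D^2)$. Consider the system of ordinary differential equations for $\boldsymbol\eta(t),\boldsymbol v(t)\in\mathbb R^N$ $$\boldsymbol\eta_t+\Big(I-\tfrac16 D_1KD_1\Big)^{-1}D_1(\boldsymbol D\boldsymbol v+\boldsymbol\eta\boldsymbol v)=\boldsymbol 0,\qquad \boldsymbol v_t+\Big(I-\tfrac16 D_2K\Big)^{-1}D_1\Big(g\boldsymbol\eta+\tfrac12\boldsymbol v^2\Big)=\boldsymbol 0,$$ where the matrices to be inverted are understood to be invertible. Then: (1) the system conserves the linear invariants $\mathcal M(t)=\boldsymbol 1^TM\boldsymbol\eta$ and $\mathcal V(t)=\boldsymbol 1^TM\boldsymbol v$, i.e. $\frac{d}{dt}\mathcal M=\frac{d}{dt}\mathcal V=0$ along every solution; (2) if $D_2=D_1^2$, then the total energy $\mathcal E(t)=\boldsymbol 1^TM\big(\tfrac12 g\boldsymbol\eta^2+\tfrac12(\boldsymbol\eta+\boldsymbol D)\boldsymbol v^2\big)$ is also conserved, i.e. $\frac{d}{dt}\mathcal E=0$ along every solution; (3) the scheme is well-balanced: it exactly preserves the lake-at-rest solution, i.e. every state with $\boldsymbol v=\boldsymbol 0$ and $\boldsymbol\eta=c\,\boldsymbol 1$, $c\in\mathbb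 R$, is a stationary solution.
   Context: Products and powers of vectors in $\mathbb R^N$ are taken componentwise: $(\boldsymbol u\boldsymbol v)_j=u_jv_j$, $(\boldsymbol u^k)_j=u_j^k$. $\boldsymbol 1=(1,\dots,1)^T$, $\boldsymbol 0=(0,\dots,0)^T$, $I$ is the identity matrix. A derivative matrix $A\in\mathbb R^{N\times N}$ is consistent if $A\boldsymbol 1=\boldsymbol 0$. A periodic first-derivative SBP (summation-by-parts) operator consists of a grid $\boldsymbol x$, a consistent first-derivative matrix $D_1$ and a symmetric positive-definite matrix $M$ with $MD_1+D_1^TM=0$. A periodic second-derivative SBP operator consists of a grid $\boldsymbol x$, a consistent second-derivative matrix $D_2$ and a symmetric positive-definite matrix $M$ with $MD_2=D_2^TM$. Throughout, $M$ is diagonal. The system is a semidiscretization (discrete in space, continuous in time) of the BBM-BBM equations with variable bathymetry $\eta_t+((\eta+D)v)_x-\frac16(D^2\eta_{xt})_x=0$, $v_t+g\eta_x+vv_x-\frac16(D^2v_t)_{xx}=0$ with periodic boundary conditions, where $\eta$ is the total water height, $v$ the velocity, $D$ the still water depth. *)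

(* Defs.v *)
From mathcomp Require Export all_boot all_order all_algebra.
From mathcomp Require Export all_classical all_reals all_analysis.
Export Order.TTheory GRing.Theory Num.Theory numFieldNormedType.Exports.

Set Implicit Arguments.
Unset Strict Implicit.
Unset Printing Implicit Defensive.

Local Open Scope classical_set_scope.
Local Open Scope ring_scope.

Definition hmul (R : realType) (N : nat) (u v : 'cV[R]_N) : 'cV[R]_N :=
  map2_mx *%R u v.

Definition hpow (R : realType) (N : nat) (u : 'cV[R]_N) (k : nat) : 'cV[R]_N :=
  map_mx (fun a => a ^+ k) u.

Notation "u \odot v" := (hmul u v)
  (at level 40, left associativity) : ring_scope.
Notation "u \^ k" := (hpow u k) (at level 29, left associativity) : ring_scope.

Definition ones (R : realType) (N : nat) : 'cV[R]_N := const_mx 1.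
Arguments ones {R N}.

Definition consistent (R : realType) (N : nat) (A : 'M[R]_N) : Prop :=
  A *m ones = 0.

Definition sym_posdef (R : realType) (N : nat) (M : 'M[R]_N) : Prop :=
  M^T = M /\ forall u : 'cV[R]_N, u != 0 -> 0 < (u^T *m M *m u) 0 0.

(* The grid only locates the nodes; no ordering or spacing is imposed on it,
   and the order of accuracy of a derivative matrix is not prescribed beyond
   its consistency. *)
Record periodic_sbp1 (R : realType) (N : nat) := PeriodicSBP1 {
  grid1 : 'cV[R]_N;
  deriv1 : 'M[R]_N;
  mass1 : 'M[R]_N;
  deriv1_consistent : consistent deriv1;
  mass1_sym_posdef : sym_posdef mass1;
  sbp1_property : mass1 *m deriv1 + deriv1^T *m mass1 = 0
}.

Record periodic_sbp2 (R : realType) (N : nat) := PeriodicSBP2 {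
  grid2 : 'cV[R]_N;
  deriv2 : 'M[R]_N;
  mass2 : 'M[R]_N;
  deriv2_consistent : consistent deriv2;
  mass2_sym_posdef : sym_posdef mass2;
  sbp2_property : mass2 *m deriv2 = deriv2^T *m mass2
}.

Definition Kmx (R : realType) (N : nat) (D : 'cV[R]_N) : 'M[R]_N := diag_mx (D \^ 2)^T.

Definition eta_mx (R : realType) (N : nat) (D1 : 'M[R]_N) (D : 'cV[R]_N) :
  'M[R]_N :=
  1%:M - 6^-1 *: (D1 *m Kmx D *m D1).

Definition v_mx (R : realType) (N : nat) (D2 : 'M[R]_N) (D : 'cV[R]_N) :
  'M[R]_N :=
  1%:M - 6^-1 *: (D2 *m Kmx D).

(* Solutions are only asked to exist on some open time interval J, since the
   system is nonlinear and need not have global solutions. *)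
Definition bbm_solution (R : realType) (N : nat) (g : R) (D1 D2 : 'M[R]_N)
    (D : 'cV[R]_N) (J : set R) (eta v : R -> 'cV[R]_N) : Prop :=
  [/\ open J, is_interval J &
      forall t, J t ->
        [/\ derivable eta t 1, derivable v t 1,
            derive1 eta t
              + invmx (eta_mx D1 D) *m D1 *m (D \odot v t + eta t \odot v t) = 0 &
            derive1 v t
              + invmx (v_mx D2 D) *m D1 *m (g *: eta t + 2^-1 *: (v t) \^ 2) = 0]].

Definition bbm_stationary (R : realType) (N : nat) (g : R) (D1 D2 : 'M[R]_N)
    (D : 'cV[R]_N) (eta0 v0 : 'cV[R]_N) : Prop :=
  bbm_solution g D1 D2 D setT (fun=> eta0) (fun=> v0).

Definition discrete_integral (R : realType) (N : nat) (M : 'M[R]_N)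
    (u : 'cV[R]_N) : R :=
  (ones^T *m M *m u) 0 0.

Definition energy_density (R : realType) (N : nat) (g : R)
    (D eta v : 'cV[R]_N) : 'cV[R]_N :=
  (2^-1 * g) *: eta \^ 2 + 2^-1 *: ((eta + D) \odot v \^ 2).

Definition conserved_on (R : realType) (J : set R) (f : R -> R) : Prop :=
  forall t, J t -> is_derive t 1 f 0.

(* Main.v *)
(* Both solution operators A = I - D1 K D1 / 6 and B = I - D2 K / 6 satisfy
   1^T M A = 1^T M B = 1^T M, because 1^T M D1 = 1^T M D2 = 0; this gives the
   linear invariants. The energy satisfies dE/dt = q^T M eta_t + p^T M v_t with
   p = (D + eta) v and q = g eta + v^2 / 2, where A eta_t = - D1 p and
   B v_t = - D1 q. If D2 = D1^2, then C = I - K D1^2 / 6 satisfies A D1 = D1 C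
   and M C = B^T M, as the diagonal matrices M and K commute. Thus, with p = C s,
   eta_t = - D1 s, and p^T M v_t = s^T M B v_t = - s^T M D1 q = q^T M D1 s
   cancels q^T M eta_t. *)
Require Import Defs.
From mathcomp Require Import ring.

Local Open Scope classical_set_scope.
Local Open Scope ring_scope.

Section linear_algebra.
Set Implicit Arguments.
Unset Strict Implicit.
Variables (R : realType) (N : nat).
Implicit Types (A B M : 'M[R]_N) (D u w p q x y : 'cV[R]_N).

Lemma sym_posdef_unitmx M : sym_posdef M -> M \in unitmx.
Proof.
move=> [_ Mpos]; rewrite unitmxE unitfE; apply/det0P => -[x x0 xM0].
have /Mpos : x^T != 0 by rewrite -(trmx0 R) (inj_eq trmx_inj).
by rewrite trmxK xM0 mul0mx mxE ltxx.
Qed.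

Lemma addmx_invmx_eq0 A B x y : A \in unitmx ->
  x + invmx A *m B *m y = 0 -> A *m x = - (B *m y).
Proof.
move=> Au /eqP; rewrite addr_eq0 => /eqP ->.
by rewrite mulmxN -mulmxA mulKVmx.
Qed.

(** A diagonal [M] acts as a set of quadrature weights, which can be moved freely between the
    factors of a componentwise product. *)
Lemma discrete_integral_hmul M u w :
  is_diag_mx M -> discrete_integral M (u \odot w) = (u^T *m M *m w) 0 0.
Proof.
case/diag_mxP => d ->; rewrite /discrete_integral !mul_mx_diag !mxE.
by apply: eq_bigr => i _; rewrite !mxE mul1r mulrCA mulrA.
Qed.

Lemma discrete_integralD M u w :
  discrete_integral M (u + w) = discrete_integral M u + discrete_integral M w.
Proof. by rewrite /discrete_integral mulmxDr mxE. Qed.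

Lemma sbp1_skew (op : periodic_sbp1 R N) :
  mass1 op *m deriv1 op = - ((deriv1 op)^T *m mass1 op).
Proof. by apply/eqP; rewrite -addr_eq0 sbp1_property. Qed.

Lemma sbp1_ones (op : periodic_sbp1 R N) :
  ones^T *m mass1 op *m deriv1 op = 0.
Proof.
rewrite -mulmxA sbp1_skew mulmxN mulmxA -trmx_mul.
by rewrite (deriv1_consistent op) trmx0 mul0mx oppr0.
Qed.

Lemma sbp2_ones (op : periodic_sbp2 R N) :
  ones^T *m mass2 op *m deriv2 op = 0.
Proof.
rewrite -mulmxA (sbp2_property op) mulmxA -trmx_mul.
by rewrite (deriv2_consistent op) trmx0 mul0mx.
Qed.

(** Common core of both linear invariants: [A] will be either solution operator, [B] the
    first-derivative matrix and [u] a time derivative. *)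
Lemma discrete_integral_eq0 M A B u w :
  ones^T *m M *m A = ones^T *m M -> ones^T *m M *m B = 0 ->
  A *m u = - (B *m w) -> discrete_integral M u = 0.
Proof.
move=> MA MB Au; rewrite /discrete_integral -MA -mulmxA Au mulmxN mulmxA MB.
by rewrite mul0mx oppr0 mxE.
Qed.

Lemma ones_eta_mx (op : periodic_sbp1 R N) D :
  ones^T *m mass1 op *m eta_mx (deriv1 op) D = ones^T *m mass1 op.
Proof.
rewrite /eta_mx mulmxBr mulmx1 -scalemxAr !mulmxA.
by rewrite sbp1_ones !mul0mx scaler0 subr0.
Qed.

Lemma ones_v_mx (op : periodic_sbp2 R N) D :
  ones^T *m mass2 op *m v_mx (deriv2 op) D = ones^T *m mass2 op.
Proof.
rewrite /v_mx mulmxBr mulmx1 -scalemxAr mulmxA.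
by rewrite sbp2_ones mul0mx scaler0 subr0.
Qed.

Lemma energy_flux_cancel (op : periodic_sbp1 R N) D p q u w :
  is_diag_mx (mass1 op) ->
  let D1 := deriv1 op in
  eta_mx D1 D \in unitmx -> v_mx (D1 *m D1) D \in unitmx ->
  eta_mx D1 D *m u = - (D1 *m p) -> v_mx (D1 *m D1) D *m w = - (D1 *m q) ->
  (q^T *m mass1 op *m u) 0 0 + (p^T *m mass1 op *m w) 0 0 = 0.
Proof.
move=> Mdiag D1 Au Bu Aeq Beq; set M := mass1 op.
have Mpos : sym_posdef M := mass1_sym_posdef op.
have D1M : D1^T *m M = - (M *m D1) by rewrite sbp1_skew opprK.
have KM : Kmx D *m M = M *m Kmx D.
  by rewrite /M; case/diag_mxP: Mdiag => d ->; exact: diag_mxC.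
pose C : 'M[R]_N := 1%:M - 6^-1 *: (Kmx D *m D1 *m D1).
have AD1 : eta_mx D1 D *m D1 = D1 *m C.
  by rewrite mulmxBl mulmxBr mul1mx mulmx1 -scalemxAl -scalemxAr !mulmxA.
have BM : (v_mx (D1 *m D1) D)^T *m M = M *m C.
  (* Each of the two transposed factors [D1] changes sign on crossing [M], so the signs cancel; then
     [KM] moves [M] to the front. *)
  rewrite /v_mx linearB/= linearZ/= trmx1 mulmxBl mulmxBr mul1mx mulmx1.
  rewrite -scalemxAl -scalemxAr !trmx_mul tr_diag_mx -!mulmxA D1M !mulmxN.
  rewrite (mulmxA _ M) D1M mulNmx mulmxN opprK -/(Kmx D).
  by rewrite !mulmxA KM.
(* By [BM], [C] inherits invertibility from [v_mx], which allows [p] to be written as [C *m s]. *)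
have Cu : C \in unitmx.
  have : M *m C \in unitmx.
    by rewrite -BM unitmx_mul unitmx_tr Bu sym_posdef_unitmx.
  by rewrite unitmx_mul => /andP[].
have [s ps] : exists s, p = C *m s by exists (invmx C *m p); rewrite mulKVmx.
have us : u = - (D1 *m s).
  by rewrite -[u](mulKmx Au) Aeq ps (mulmxA D1) -AD1 -mulmxA mulmxN mulKmx.
have MCT : C^T *m M = M *m v_mx (D1 *m D1) D.
  by apply: trmx_inj; rewrite !trmx_mul trmxK Mpos.1 BM.
(* Both sides are 1x1, so the transpose leaves the entry unchanged and the two energy terms become
   opposite. *)
have -> : p^T *m M *m w = (q^T *m M *m (D1 *m s))^T.
  rewrite ps trmx_mul -(mulmxA s^T) MCT -!mulmxA Beq !trmx_mul trmxK Mpos.1.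
  by rewrite !mulmxN !mulmxA -(mulmxA s^T D1^T) D1M mulmxN mulNmx !mulmxA.
by rewrite us mulmxN [X in _ + X]mxE [X in X + _]mxE addNr.
Qed.

End linear_algebra.

Section differentiation.
Set Implicit Arguments.
Unset Strict Implicit.
Variables (R : realType) (N : nat).
Implicit Types (f : R -> 'cV[R]_N) (D : 'cV[R]_N) (t : R).

Lemma is_derive_col f t i :
  derivable f t 1 -> is_derive t 1 (fun s => f s i 0) (derive1 f t i 0).
Proof.
move=> df; rewrite derive1E derive_mx// mxE.
by apply/derivableP; move/derivable_mxP: df; exact.
Qed.

(** The hypothesis is entrywise because the derivative of the energy density is computed in that
    form. *)
Lemma is_derive_discrete_integral (M : 'M[R]_N) f t (df : 'cV[R]_N) :
  (forall i, is_derive t 1 (fun s => f s i 0) (df i 0)) ->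
  is_derive t 1 (fun s => discrete_integral M (f s)) (discrete_integral M df).
Proof.
move=> fE; have H i : is_derive t 1
    ((ones^T *m M) 0 i \*: (fun s => f s i 0)) ((ones^T *m M) 0 i *: df i 0).
  exact: is_deriveZ.
have := is_derive_sum H; rewrite /discrete_integral mxE.
congr (is_derive _ _ _ _); apply/funext => s.
by rewrite fct_sumE mxE.
Qed.

(** Chain rule: the factors of the two time derivatives are the partial derivatives of the density,
    and they are also the fluxes under [D1] in the system, swapped. *)
Lemma is_derive_energy_density g D (eta v : R -> 'cV[R]_N) t i :
  derivable eta t 1 -> derivable v t 1 ->
  is_derive t 1 (fun s => energy_density g D (eta s) (v s) i 0)
    (((g *: eta t + 2^-1 *: v t \^ 2) \odot derive1 eta t +
      (D \odot v t + eta t \odot v t) \odot derive1 v t) i 0).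
Proof.
move=> /(is_derive_col i) deta /(is_derive_col i) dv.
set e := fun s => eta s i 0; set w := fun s => v s i 0.
(* As a polynomial expression in the functions [e] and [w], the entry is differentiated by instance
   inference. *)
rewrite (_ : (fun s => _) =
  (2^-1 * g) \*: e ^+ 2 + 2^-1 \*: ((e + cst (D i 0)) * w ^+ 2)); last first.
  by apply/funext => s; rewrite !mxE.
apply: is_derive_eq; rewrite !mxE /GRing.scale/= !fctE /e /w /=.
by field.
Qed.

End differentiation.

Theorem theorem3p8 (R : realType) (N : nat)
    (op1 : periodic_sbp1 R N) (op2 : periodic_sbp2 R N)
    (same_grid : grid2 op2 = grid1 op1)
    (same_mass : mass2 op2 = mass1 op1)
    (mass_diag : is_diag_mx (mass1 op1))
    (g : R) (g_gt0 : 0 < g) (depth : R -> R) :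
  let M := mass1 op1 in
  let D1 := deriv1 op1 in
  let D2 := deriv2 op2 in
  let D := map_mx depth (grid1 op1) in
  eta_mx D1 D \in unitmx ->
  v_mx D2 D \in unitmx ->
  [/\ (forall (J : set R) (eta v : R -> 'cV[R]_N),
         bbm_solution g D1 D2 D J eta v ->
         conserved_on J (fun t => discrete_integral M (eta t)) /\
         conserved_on J (fun t => discrete_integral M (v t))),
      (D2 = D1 *m D1 ->
       forall (J : set R) (eta v : R -> 'cV[R]_N),
         bbm_solution g D1 D2 D J eta v ->
         conserved_on J
           (fun t => discrete_integral M (energy_density g D (eta t) (v t)))) &
      (forall c : R, bbm_stationary g D1 D2 D (c *: ones) 0)].
Proof.
move=> M D1 D2 D Au Bu; split.
- move=> J eta v [_ _ sol]; split=> t /sol[deta dv Aeta Bv].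
  (* The target derivative 0 is replaced by the discrete integral of [derive1 eta t]. *)
  + rewrite -(discrete_integral_eq0 (ones_eta_mx op1 D) (sbp1_ones op1)
      (addmx_invmx_eq0 Au Aeta)).
    by apply: is_derive_discrete_integral => i; exact: is_derive_col.
  + have MB : ones^T *m M *m v_mx D2 D = ones^T *m M.
      by rewrite /M -same_mass ones_v_mx.
    rewrite -(discrete_integral_eq0 MB (sbp1_ones op1) (addmx_invmx_eq0 Bu Bv)).
    by apply: is_derive_discrete_integral => i; exact: is_derive_col.
- move=> D2E J eta v [_ _ sol] t /sol[deta dv Aeta Bv].
  move: Bu (addmx_invmx_eq0 Au Aeta) (addmx_invmx_eq0 Bu Bv); rewrite D2E.
  move=> Bu' Aeq Beq; rewrite -(energy_flux_cancel mass_diag Au Bu' Aeq Beq).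
  (* The two pairings that sum to 0 merge into one integral, that of the differentiated density. *)
  rewrite -!discrete_integral_hmul// -discrete_integralD.
  by apply: is_derive_discrete_integral => i; exact: is_derive_energy_density.
- move=> c; split; [exact: openT | by [] | move=> t _].
  have h0 u : u \odot 0 = 0 :> 'cV[R]_N.
    by apply/matrixP => i j; rewrite !mxE mulr0.
  have p0 : (0 : 'cV[R]_N) \^ 2 = 0.
    by apply/matrixP => i j; rewrite !mxE expr0n.
  split; [exact: derivable_cst | exact: derivable_cst | |].
  + by rewrite derive1_cst !h0 addr0 mulmx0 addr0.
  (* At rest the remaining flux is a multiple of [ones], which [D1] annihilates by consistency. *)
  + rewrite derive1_cst p0 scaler0 addr0 scalerA -mulmxA -scalemxAr.
    by rewrite (deriv1_consistent op1) scaler0 mulmx0 addr0.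
Qed.
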